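(* Let $\{S_i\}_{i\in\mathbb{N}}$ be an infinite iterated function system on $[0,2]^d$ such that $S_i([0,2]^d)\subseteq[0,1]^d$ for all $i\in\mathbb{N}$ and such that the contraction ratios of the maps $S_i$ accumulate only at zero. Let $V=[0,1)^d$ and equip $V^{\mathbb{N}}$ with the metric $d(t,s)=\left(\sum_{i=1}^\infty\|t_i-s_i\|^2/i^2\right)^{1/2}$. For $t=(t_1,t_2,\ldots)\in V^{\mathbb{N}}$ let $F_t$ be the attractor of the IIFS $\{S_i+t_i\}_{i\in\mathbb{N}}$ on $[0,2]^d$. Then for a residual set of $t\in V^{\mathbb{N}}$, the attractor $F_t$ is somewhere dense in $[0,2]^d$. In particular, for all $\theta\in(0,1]$ (and such $t$), $$\dim_{\theta}F_t=\dim_{\mathrm B}F_t=d.$$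
   Context: An infinite iterated function system (IIFS) on a compact connected set $X\subset\mathbb{R}^d$ with more than one point is a countable collection of maps $S_i\colon X\to X$ for which there is $\rho\in[0,1)$ with $\|S_i(x)-S_i(y)\|\le\rho\|x-y\|$ for all $x,y\in X$ and all $i$ (Euclidean norm). Its limit set (attractor) is $F=\bigcup_{w\in\mathbb{N}^{\mathbb{N}}}\bigcap_{n=1}^\infty S_{w_1}\circ\cdots\circ S_{w_n}(X)$ when the index set is $\mathbb{N}$. The contraction ratio of $S_i$ is its smallest Lipschitz constant; that the contraction ratios accumulate only at zero means that the sequence of ratios has $0$ as its only accumulation point (i.e. it tends to $0$). $(S_i+t_i)(x)=S_i(x)+t_i$ for $x\in[0,2]^d$. A set is somewhere dense if its closure has non-empty interior. A subset of $V^{\mathbb{N}}$ is residual (comeagre) if it contains a countable intersection of open dense subsets of $V^{\mathbb{N}}$. For $\theta\in(0,1]$ and non-empty bounded $E\subset\mathbb{R}^d$: $\overline{\dim}_{\theta}E$ is the infimum of $s\ge0$ such that for all $\epsilon>0$ there is $\delta_0\in(0,1]$ such that for all $\delta\in(0,\delta_0)$ there is a cover $\{U_1,U_2,\ldots\}$ of $E$ with diameters $\delta^{1/\theta}\le|U_i|\le\delta$ for all $i$ and $\sum_i|U_i|^s\le\epsilon$; $\underline{\dim}_{\theta}E$ is the infimum of $s\ge0$ such that for all $\epsilon>0$ and $\delta_0\in(0,1]$ there exist $\delta\in(0,\delta_0)$ and a cover with the same properties. $\dim_\theta E$ (respectively the box dimension $\dim_{\mathrm B}E$) denotes the common value when the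 upper and lower versions coincide; the claim includes that they do. *)

(* Defs.v *)
From HB Require Import structures.
From mathcomp Require Import all_boot all_order all_algebra.
From mathcomp Require Import all_classical all_reals all_analysis.
From mathcomp Require Import ring lra.

Set Implicit Arguments.
Unset Strict Implicit.
Unset Printing Implicit Defensive.

Import Order.TTheory GRing.Theory Num.Theory.
Import numFieldNormedType.Exports.

Local Open Scope classical_set_scope.
Local Open Scope ring_scope.

Section Euclidean.
Context {R : realType} {d : nat}.
Implicit Types (x y : 'rV[R]_d) (U : set 'rV[R]_d).

(* The library norm on row vectors is the sup norm; it induces the same
   topology, but the Euclidean norm is the one used for metric notions. *)
Definition enorm x : R := Num.sqrt (\sum_(j < d) x 0 j ^+ 2).

(* [ediam set0 = -oo] and [ediam U = +oo] for unbounded [U]. *)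
Definition ediam U : \bar R :=
  ereal_sup [set (enorm (x - y))%:E | x in U & y in U].

Definition cube (a b : R) : set 'rV[R]_d :=
  [set x | forall j, a <= x 0 j <= b].

End Euclidean.

Definition unit_box (R : realType) (d : nat) : set 'rV[R]_d :=
  [set x | forall j, 0 <= x 0 j < 1].
Arguments unit_box : clear implicits.

(* Sequences are indexed from 0; the alias keeps the metric below from clashing
   with the product topology on functions. *)
Definition translations (R : realType) (d : nat) := nat -> unit_box R d.

Section SquareSums.
Context {R : realType}.

Lemma minkowski_sum (I : Type) (r : seq I) (a b : I -> R) :
  Num.sqrt (\sum_(i <- r) (a i + b i) ^+ 2) <=
  Num.sqrt (\sum_(i <- r) a i ^+ 2) + Num.sqrt (\sum_(i <- r) b i ^+ 2).
Proof.
elim: r => [|i r IH]; first by rewrite !big_nil sqrtr0 addr0.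
rewrite !big_cons.
have P0 (f : I -> R) : 0 <= \sum_(j <- r) f j ^+ 2.
  by apply: sumr_ge0 => j _; exact: sqr_ge0.
set P := \sum_(j <- r) (a j + b j) ^+ 2 in IH *.
set A := \sum_(j <- r) a j ^+ 2 in IH *.
set B := \sum_(j <- r) b j ^+ 2 in IH *.
have HP : 0 <= P := P0 _. have HA : 0 <= A := P0 _. have HB : 0 <= B := P0 _.
have sA := sqrtr_ge0 A. have sB := sqrtr_ge0 B. have sP := sqrtr_ge0 P.
have eA := sqr_sqrtr HA. have eB := sqr_sqrtr HB. have eP := sqr_sqrtr HP.
set u := Num.sqrt A in IH sA eA *. set v := Num.sqrt B in IH sB eB *.
rewrite -eA -eB.
have ea : 0 <= a i ^+ 2 + u ^+ 2 by rewrite addr_ge0 ?sqr_ge0.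
have eb : 0 <= b i ^+ 2 + v ^+ 2 by rewrite addr_ge0 ?sqr_ge0.
have fa := sqrtr_ge0 (a i ^+ 2 + u ^+ 2).
have fb := sqrtr_ge0 (b i ^+ 2 + v ^+ 2).
have ga := sqr_sqrtr ea. have gb := sqr_sqrtr eb.
set s := Num.sqrt (a i ^+ 2 + u ^+ 2) in fa ga *.
set t := Num.sqrt (b i ^+ 2 + v ^+ 2) in fb gb *.
rewrite -[leRHS](@ger0_norm _ (s + t)) ?addr_ge0// -sqrtr_sqr ler_sqrt ?sqr_ge0//.
have PP : P <= (u + v) ^+ 2 by rewrite -eP ler_sqr ?nnegrE ?addr_ge0.
have CS : a i * b i + u * v <= s * t.
  apply: (le_trans (ler_norm _)).
  rewrite -[leRHS]ger0_norm ?mulr_ge0// -ler_sqr ?nnegrE// !real_normK ?num_real//.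
  rewrite [leRHS]exprMn ga gb.
  have := sqr_ge0 (a i * v - b i * u). nra.
have -> : (s + t) ^+ 2 = s ^+ 2 + t ^+ 2 + 2 * (s * t) by ring.
rewrite ga gb; nra.
Qed.

Lemma sum_invsq_le (n : nat) :
  \sum_(0 <= i < n) (i.+1%:R ^+ 2)^-1 <= 2 - (n.+1%:R)^-1 :> R.
Proof.
case: n => [|n]; first by rewrite big_geq// invr1; lra.
have : \sum_(0 <= i < n.+1) (i.+1%:R ^+ 2)^-1 <= 2 - (n.+1%:R)^-1 :> R.
  elim: n => [|n IH]; first by rewrite big_nat1 expr1n invr1; lra.
  rewrite big_nat_recr//=; apply: (le_trans (lerD IH (lexx _))).
  have n0 : 0 < n.+1%:R :> R by rewrite ltr0n.
  have m0 : 0 < n.+2%:R :> R by rewrite ltr0n.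
  have e : n.+2%:R = n.+1%:R + 1 :> R by rewrite -natr1.
  rewrite -subr_ge0.
  have key (p q : R) : 0 < p -> q = p + 1 ->
      2 - q^-1 - (2 - p^-1 + (q ^+ 2)^-1) = (p * q ^+ 2)^-1.
    move=> p0 ->; have p1 : 0 < p + 1 by rewrite addr_gt0.
    by field; rewrite !gt_eqF.
  rewrite (key _ _ n0 e).
  by rewrite invr_ge0 mulr_ge0// ?exprn_ge0// ltW.
move=> /le_trans; apply; rewrite lerB// lef_pV2 ?posrE ?ltr0n// ler_nat//.
Qed.

End SquareSums.

Section EuclideanNorm.
Context {R : realType} {d : nat}.
Implicit Types x y z : 'rV[R]_d.

Lemma enorm_ge0 x : 0 <= enorm x. Proof. exact: sqrtr_ge0. Qed.

Lemma sqr_enorm x : enorm x ^+ 2 = \sum_(j < d) x 0 j ^+ 2.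
Proof. by rewrite sqr_sqrtr// sumr_ge0// => j _; exact: sqr_ge0. Qed.

Lemma enorm_triangle x y : enorm (x + y) <= enorm x + enorm y.
Proof.
rewrite /enorm; under eq_bigr do rewrite mxE.
exact: minkowski_sum.
Qed.

Lemma enormN x : enorm (- x) = enorm x.
Proof. by rewrite /enorm; congr Num.sqrt; apply: eq_bigr => j _; rewrite mxE sqrrN. Qed.

Lemma enorm0 : enorm (0 : 'rV[R]_d) = 0.
Proof. by rewrite /enorm big1 ?sqrtr0// => j _; rewrite mxE expr0n. Qed.

Lemma enorm_eq0 x : enorm x = 0 -> x = 0.
Proof.
move=> /(congr1 (fun r => r ^+ 2)); rewrite sqr_enorm expr0n/= => /eqP.
rewrite psumr_eq0 => [/allP/= x0|j _]; last exact: sqr_ge0.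
apply/rowP => j; rewrite mxE.
by have /(_ (mem_index_enum _))/= := x0 j; rewrite sqrf_eq0 => /eqP.
Qed.

End EuclideanNorm.

Section TranslationMetric.
Context {R : realType} {d : nat}.
Implicit Types t s : translations R d.

Definition tdist_term t s (i : nat) : R :=
  enorm (val (t i) - val (s i)) ^+ 2 / i.+1%:R ^+ 2.

Definition tdist t s : R := Num.sqrt (limn (series (tdist_term t s))).

Lemma tdist_term_ge0 t s i : 0 <= tdist_term t s i.
Proof. by rewrite divr_ge0// exprn_ge0// enorm_ge0. Qed.

Lemma tdist_term_le t s i : tdist_term t s i <= d%:R / i.+1%:R ^+ 2.
Proof.
rewrite ler_wpM2r ?invr_ge0 ?exprn_ge0// sqr_enorm.
rewrite -[X in _ <= X%:R](card_ord d) -sum1_card natr_sum ler_sum// => j _.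
rewrite !mxE.
have /(_ j)/andP[t0 t1] := set_valP (t i).
have /(_ j)/andP[s0 s1] := set_valP (s i).
rewrite -(expr1n _ 2) -[leLHS]real_normK ?num_real// ler_sqr ?nnegrE//.
by rewrite ler_norml; apply/andP; split; rewrite /set_val/= in t0 t1 s0 s1; lra.
Qed.

Lemma is_cvg_tdist t s : cvgn (series (tdist_term t s)).
Proof.
apply: nondecreasing_is_cvgn.
  by apply/nondecreasing_seqP => n; rewrite !seriesEnat/= big_nat_recr//= lerDl tdist_term_ge0.
exists (d%:R * 2) => _ [n _ <-]; rewrite seriesEnat/=.
apply: (@le_trans _ _ (\sum_(0 <= i < n) d%:R * (i.+1%:R ^+ 2)^-1)).
  by apply: ler_sum => i _; exact: tdist_term_le.
rewrite -mulr_sumr ler_wpM2l//; apply: (le_trans (sum_invsq_le n)).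
by rewrite gerBl invr_ge0.
Qed.

Lemma tdist_partial_le t s n :
  series (tdist_term t s) n <= limn (series (tdist_term t s)).
Proof.
apply: nondecreasing_cvgn_le; last exact: is_cvg_tdist.
by apply/nondecreasing_seqP => m; rewrite !seriesEnat/= big_nat_recr//= lerDl tdist_term_ge0.
Qed.

Lemma tdist_lim_ge0 t s : 0 <= limn (series (tdist_term t s)).
Proof. by apply: le_trans (tdist_partial_le t s 0); rewrite seriesEnat/= big_geq. Qed.

Lemma tdistxx t : tdist t t = 0.
Proof.
rewrite /tdist (_ : series _ = cst 0) ?lim_cst ?sqrtr0//.
apply/funext => n; rewrite seriesEnat/= big1// => i _.
by rewrite /tdist_term subrr enorm0 expr0n mul0r.
Qed.

Lemma tdist_sym t s : tdist t s = tdist s t.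
Proof.
rewrite /tdist (_ : tdist_term t s = tdist_term s t)//.
by apply/funext => i; rewrite /tdist_term -enormN opprB.
Qed.

Lemma tdist_positivity t s : tdist t s = 0 -> t = s.
Proof.
move=> /eqP; rewrite sqrtr_eq0 => ts0; apply/funext => i.
apply: val_inj; apply/eqP; rewrite -subr_eq0; apply/eqP/enorm_eq0/eqP.
have : tdist_term t s i <= 0.
  apply: le_trans ts0; apply: le_trans (tdist_partial_le t s i.+1).
  rewrite seriesEnat/= big_nat_recr//= lerDr sumr_ge0// => j _.
  exact: tdist_term_ge0.
move=> le0; have : tdist_term t s i == 0 by rewrite eq_le le0 tdist_term_ge0.
by rewrite mulf_eq0 invr_eq0 !sqrf_eq0 pnatr_eq0 orbF.
Qed.

Lemma tdist_triangle t s u : tdist s u <= tdist s t + tdist t u.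
Proof.
have T0 : 0 <= tdist s t + tdist t u by rewrite addr_ge0// sqrtr_ge0.
rewrite -[leRHS]ger0_norm// -sqrtr_sqr ler_sqrt ?sqr_ge0//.
apply: limr_le; first exact: is_cvg_tdist.
near=> n.
pose f (x y : translations R d) i : R := enorm (val (x i) - val (y i)) / i.+1%:R.
have fE x y : series (tdist_term x y) n = \sum_(0 <= i < n) f x y i ^+ 2.
  by rewrite seriesEnat/=; apply: eq_bigr => i _; rewrite /f expr_div_n.
have S0 x y : 0 <= \sum_(0 <= i < n) f x y i ^+ 2.
  by apply: sumr_ge0 => i _; exact: sqr_ge0.
rewrite fE -[leLHS]sqr_sqrtr// ler_sqr ?nnegrE ?sqrtr_ge0//.
apply: (@le_trans _ _ (Num.sqrt (\sum_(0 <= i < n) (f s t i + f t u i) ^+ 2))).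
  rewrite ler_sqrt; last by apply: sumr_ge0 => i _; exact: sqr_ge0.
  apply: ler_sum => i _; rewrite ler_sqr ?nnegrE ?addr_ge0 ?divr_ge0 ?enorm_ge0//.
  rewrite /f -mulrDl ler_wpM2r ?invr_ge0//.
  apply: le_trans (enorm_triangle _ _).
  by rewrite addrA subrK.
apply: (le_trans (minkowski_sum _ _ _)).
by rewrite lerD// ler_sqrt ?tdist_lim_ge0// -fE tdist_partial_le.
Unshelve. all: by end_near. Qed.

End TranslationMetric.

HB.instance Definition _ (R : realType) (d : nat) :=
  gen_eqMixin (translations R d).
HB.instance Definition _ (R : realType) (d : nat) :=
  gen_choiceMixin (translations R d).
HB.instance Definition _ (R : realType) (d : nat) :=
  @isMetric.Build R (translations R d) tdist
    tdistxx tdist_positivity tdist_sym tdist_triangle.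

Section Topology.
Context {T : topologicalType}.

Definition residual (A : set T) : Prop :=
  exists G : nat -> set T,
    (forall n, open (G n) /\ dense (G n)) /\ \bigcap_n G n `<=` A.

Definition somewhere_dense (E : set T) : Prop := interior (closure E) !=set0.

End Topology.

Section IIFS.
Context {R : realType} {d : nat}.
Implicit Types (X : set 'rV[R]_d) (f : 'rV[R]_d -> 'rV[R]_d)
  (S : nat -> 'rV[R]_d -> 'rV[R]_d).

(* A map X -> X is represented by a total function, of which only the values on
   X matter. *)
Definition is_lipschitz_on X (c : R) f : Prop :=
  forall x y, X x -> X y -> enorm (f x - f y) <= c * enorm (x - y).

Definition contraction_ratio X f : R :=
  inf [set c | 0 <= c /\ is_lipschitz_on X c f].

Definition is_IIFS X S : Prop :=
  [/\ compact X, connected X, (exists x y, [/\ X x, X y & x != y]),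
      (forall i, S i @` X `<=` X) &
      exists2 rho : R, 0 <= rho < 1 & forall i, is_lipschitz_on X rho (S i)].

(* [word_map S w n] is S (w 0) \o S (w 1) \o ... \o S (w n.-1). *)
Definition word_map S (w : nat -> nat) (n : nat) : 'rV[R]_d -> 'rV[R]_d :=
  fun x => foldr S x (mkseq w n).

Definition limit_set X S : set 'rV[R]_d :=
  \bigcup_(w in [set: nat -> nat])
    \bigcap_(n in [set n | (0 < n)%N]) (word_map S w n @` X).

Definition translate S (t : translations R d) : nat -> 'rV[R]_d -> 'rV[R]_d :=
  fun i x => S i x + val (t i).

End IIFS.

Section Dimensions.
Context {R : realType} {d : nat}.
Implicit Types (E : set 'rV[R]_d) (theta s eps delta : R).

Local Open Scope ereal_scope.

(* [C] may be finite or countably infinite; the lower bound on diameters rules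
   out the empty set. *)
Definition scaled_cover theta s eps delta E : Prop :=
  exists C : set (set 'rV[R]_d),
    [/\ countable C,
        E `<=` \bigcup_(U in C) U,
        (forall U, C U -> (delta `^ theta^-1)%:E <= ediam U <= delta%:E) &
        \esum_(U in C) (ediam U `^ s) <= eps%:E].

Definition upper_intermediate_dim theta E : \bar R :=
  ereal_inf [set s%:E | s in [set s : R | (0 <= s)%R /\
    forall eps, (0 < eps)%R -> exists2 delta0 : R, (0 < delta0 <= 1)%R &
    forall delta, (0 < delta < delta0)%R -> scaled_cover theta s eps delta E]].

Definition lower_intermediate_dim theta E : \bar R :=
  ereal_inf [set s%:E | s in [set s : R | (0 <= s)%R /\
    forall eps delta0, (0 < eps)%R -> (0 < delta0 <= 1)%R ->
    exists2 delta : R, (0 < delta < delta0)%R &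
    scaled_cover theta s eps delta E]].

Definition has_intermediate_dim theta E (v : \bar R) : Prop :=
  lower_intermediate_dim theta E = v /\ upper_intermediate_dim theta E = v.

(* Smallest number of sets of diameter at most [delta] covering [E]; only
   meaningful when [E] is bounded, otherwise the infimum is over [set0]. *)
Definition covering_number E delta : R :=
  inf [set n%:R | n in [set n : nat | exists U : 'I_n -> set 'rV[R]_d,
    E `<=` \bigcup_i U i /\ forall i, ediam (U i) <= delta%:E]].

Definition box_ratio E delta : \bar R :=
  (ln (covering_number E delta) / - ln delta)%:E.

Definition upper_box_dim E : \bar R := limf_esup (box_ratio E) (0%R : R)^'+.

Definition lower_box_dim E : \bar R := limf_einf (box_ratio E) (0%R : R)^'+.

Definition has_box_dim E (v : \bar R) : Prop :=
  lower_box_dim E = v /\ upper_box_dim E = v.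

End Dimensions.

(* Main.v *)
Require Import Defs.
From mathcomp Require Import all_boot all_order all_algebra.
From mathcomp Require Import all_classical all_reals all_analysis.
From mathcomp Require Import ring lra zify.
Set Implicit Arguments.
Unset Strict Implicit.
Unset Printing Implicit Defensive.
Import Order.TTheory GRing.Theory Num.Theory.
Import numFieldNormedType.Exports.
Local Open Scope classical_set_scope.
Local Open Scope ring_scope.

(** The images of the maps [S i] shrink to points, since the contraction ratios
    tend to 0; by compactness the values [S i 0] have a cluster point [c].
    Given a point [g] of the unit box and a precision, the sequences
    [t] such that [t i] is close to [g] for some large [i] with [S i 0] close to
    [c] form an open dense set: open because it constrains one coordinate only
    ([open_visits]), dense because changing a coordinate of large index costs
    little in the weighted metric ([dense_visits]).  If [t] lies in all these
    sets for [g] in a countable dense set, the maps [S i + t i] have images close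
    to any prescribed point of [c + [0,1)^d]; each such map has a fixed point,
    which lies both in its image and in the attractor ([attractor_near]).  Hence
    the attractor is dense in a ball of the sup norm
    ([residual_attractor_dense]).

    The dimensions then follow for any subset [E] of [[0,2]^d] which is dense in
    such a ball.  From above, a grid of cubes of diameter exactly [delta] covers
    [E] by at most [C * delta ^- d] sets ([grid_cover]).  From below, [E] need
    not be closed, so Lebesgue measure and countable subadditivity say nothing;
    but in the covers in question the bounds on the diameters stay above some
    positive scale, and a counting argument takes their place ([cover_mass]): cut
    the ball into cells of side [h] at most that scale, pick a point of [E] in
    each cell, and assign to it a set containing it.  A set whose diameter is at
    most [r], with [r >= h], is assigned to at most [(5 * r / h) ^ d] cells, hence
    the sum of the [r ^ d] is at least a positive constant independent of the
    cover. *)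

(** * Counting cells met by the sets of a cover *)

(** Cells with a common label lie within [m] of one of them in each coordinate,
    so each label is used at most [(2 * m + 1) ^ d] times. *)
Lemma cell_fibre_count (d M : nat) (J : eqType) (u : {ffun 'I_d -> 'I_M} -> J)
    (m : J -> nat) :
  (forall k k' j, u k = u k' -> (k' j <= k j + m (u k))%N) ->
  (M ^ d <= \sum_(U <- undup [seq u k | k : {ffun 'I_d -> 'I_M}])
              (m U).*2.+1 ^ d)%N.
Proof.
move=> close; set s := (X in undup X).
have <- : size s = (M ^ d)%N by rewrite size_image card_ffun !card_ord.
have <- : (\sum_(U <- undup s) count_mem U s = size s)%N.
  rewrite -[RHS]sum1_size -(big_undup_iterop_count addn s xpredT (fun=> 1%N)).
  by apply: eq_bigr => U _; rewrite Monoid.iteropE iter_addn_0 mul1n.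
rewrite !big_seq; apply: leq_sum => U; rewrite mem_undup => /mapP[k0 _ ->{U}].
(* The offset from k0 is shifted by m to be a natural number; it determines k
   among the cells with the label of k0. *)
pose code (k : {ffun 'I_d -> 'I_M}) : {ffun 'I_d -> 'I_(m (u k0)).*2.+1} :=
  [ffun j => inord (k j + m (u k0) - k0 j)].
have codeE k : u k = u k0 ->
    forall j, code k j = (k j + m (u k0) - k0 j)%N :> nat.
  move=> e j; rewrite ffunE inordK// ltnS.
  by rewrite leq_subLR -addnn addnA leq_add2r; exact: close _ _ j (esym e).
have -> : count_mem (u k0) s = #|[pred k | u k == u k0]|.
  rewrite /s /image_mem count_map cardE -size_filter; congr size.
  rewrite -filter_predI; apply: eq_filter => k.
  by rewrite !inE andbT.
have -> : ((m (u k0)).*2.+1 ^ d)%N = #|{ffun 'I_d -> 'I_(m (u k0)).*2.+1}|.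
  by rewrite card_ffun !card_ord.
rewrite -(@card_in_imset _ _ code) ?max_card// => k k'.
rewrite !inE => /eqP ek /eqP ek' ekk'; apply/ffunP => j; apply/val_inj => /=.
have cancel (a b c q x : nat) : x = (a + q - c)%N -> x = (b + q - c)%N ->
    (c <= a + q)%N -> (c <= b + q)%N -> a = b by lia.
apply: (cancel _ _ (k0 j) (m (u k0)) _ (codeE _ ek j)).
- by rewrite ekk' codeE.
- by rewrite -ek; exact: close.
- by rewrite -ek'; exact: close.
Qed.

Lemma coord_le_enorm {R : realType} {d : nat} (x : 'rV[R]_d) j :
  `|x 0 j| <= enorm x.
Proof.
rewrite -sqrtr_sqr /enorm ler_sqrt ?sumr_ge0// => [|i _]; last exact: sqr_ge0.
by rewrite (bigD1 j)//= lerDl sumr_ge0// => i _; exact: sqr_ge0.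
Qed.

Lemma enorm_le_ediam {R : realType} {d : nat} (U : set 'rV[R]_d) x y r :
  (ediam U <= r%:E)%E -> U x -> U y -> enorm (x - y) <= r.
Proof.
move=> Ur Ux Uy; rewrite -lee_fin; apply: le_trans Ur.
by apply: ereal_sup_ubound; exists x => //; exists y.
Qed.

Lemma rV_ballP {R : realType} {d : nat} (x y : 'rV[R]_d) e : 0 < e ->
  ball x e y <-> forall j, `|x 0 j - y 0 j| < e.
Proof.
move=> e0; split=> [[_ /(_ 0)]//|xy]; split=> // i j.
by rewrite ord1; exact: xy.
Qed.

(** The ball [ball x e] is a cube of side [2 * e], cut here into [M ^ d] cells of
    half side [e / M]; density is applied at the centre of each cell. *)
Lemma cell_points {R : realType} {d : nat} (E : set 'rV[R]_d) x e M :
    0 < e -> (0 < M)%N -> ball x e `<=` closure E ->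
  forall k : {ffun 'I_d -> 'I_M}, exists2 p, E p &
    forall j, `|p 0 j - (x 0 j - e + 2 * e / M%:R * (k j)%:R + e / M%:R)|
              < e / M%:R.
Proof.
move=> e0 M0 xE k; set h := e / M%:R.
have h0 : 0 < h by rewrite divr_gt0 ?ltr0n.
have eh : e = h * M%:R by rewrite divfK// pnatr_eq0 -lt0n.
pose y : 'rV[R]_d := \row_j (x 0 j - e + 2 * e / M%:R * (k j)%:R + h).
have [p [Ep yp]] : (E `&` ball y h) !=set0.
  apply: xE; last exact: nbhsx_ballx.
  apply/rV_ballP => // j; rewrite mxE -(mulrA 2) -/h.
  have : h * ((k j)%:R + 1) <= e by rewrite eh ler_pM2l// natr1 ler_nat.
  have : 0 <= h * (k j)%:R by rewrite mulr_ge0// ltW.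
  by move=> ? ?; rewrite ltr_norml; lra.
exists p => // j; move/rV_ballP: yp => /(_ h0 j).
by rewrite mxE distrC.
Qed.

(** Lower bound for the [d]-dimensional mass of a cover of a set which is merely
    dense in a cube.  The hypothesis that no [r i] is below the mesh
    [2 * e / M] is what makes the number of cells meeting [U i] comparable with
    [(r i) ^ d].  The index type and the bounds [r i] are left free because the
    lemma serves both for covers given as sets of sets, with their own diameters,
    and for finite families, with one common bound. *)
Lemma cover_mass {R : realType} {d : nat} (E : set 'rV[R]_d) x e M
    (J : choiceType) (D : set J) (U : J -> set 'rV[R]_d) (r : J -> R) :
    0 < e -> (0 < M)%N -> ball x e `<=` closure E ->
    E `<=` \bigcup_(i in D) U i ->
    (forall i, D i -> (ediam (U i) <= (r i)%:E)%E /\ 2 * e / M%:R <= r i) ->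
  exists s : seq J, [/\ uniq s, {in s, forall i, D i} &
    (2 * e) ^+ d <= \sum_(i <- s) (5 * r i) ^+ d].
Proof.
move=> e0 M0 xE cov diam; set h := 2 * e / M%:R.
have M0' : 0 < M%:R :> R by rewrite ltr0n.
have h0 : 0 < h by rewrite divr_gt0 ?mulr_gt0.
have /choice[p pP] : forall k : {ffun 'I_d -> 'I_M}, exists p, E p /\
    forall j, x 0 j - e + h * (k j)%:R < p 0 j < x 0 j - e + h * (k j)%:R + h.
  move=> k; have [p Ep pk] := cell_points e0 M0 xE k; exists p; split=> // j.
  have := pk j; rewrite ltr_norml -/h.
  have -> : e / M%:R = h / 2 by rewrite /h; field; rewrite gt_eqF.
  lra.
have /choice[u uP] : forall k, exists i, D i /\ U i (p k).
  by move=> k; have [/cov[i Di Ui] _] := pP k; exists i.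
(* Points of U i differ by at most r i in each coordinate, so their cells differ
   by fewer than r i / h + 1 steps. *)
pose m i := (Num.truncn (r i / h)).+1.
exists (undup [seq u k | k : {ffun 'I_d -> 'I_M}]); split.
- exact: undup_uniq.
- by move=> i; rewrite mem_undup => /mapP[k _ ->]; have [] := uP k.
have close k k' j : u k = u k' -> (k' j <= k j + m (u k))%N.
  move=> ukk'; have [Dk Uk] := uP k; have [_ Uk'] := uP k'.
  have [dk hk] := diam _ Dk; rewrite -ukk' in Uk'.
  have := le_trans (coord_le_enorm _ j) (enorm_le_ediam dk Uk' Uk).
  rewrite !mxE ler_norml => /andP[_ pp].
  have [_ /(_ j)/andP[pk _]] := pP k'; have [_ /(_ j)/andP[_ pk']] := pP k.
  have : h * (k' j)%:R < h * ((k j)%:R + 1 + r (u k) / h).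
    rewrite !mulrDr mulr1 [h * (_ / h)]mulrC divfK ?gt_eqF//; lra.
  rewrite ltr_pM2l// => kk'.
  have /truncn_itv/andP[_ tr] : 0 <= r (u k) / h.
    by rewrite divr_ge0 ?(le_trans _ hk) ?ltW.
  rewrite -ltnS -(ltr_nat R) /m -addnS natrD -natr1; lra.
have := cell_fibre_count close; rewrite -(ler_nat R) natrX natr_sum => count.
have -> : (2 * e) ^+ d = h ^+ d * M%:R ^+ d.
  by rewrite -exprMn /h divfK// gt_eqF.
apply: le_trans (ler_wpM2l _ count) _; first by rewrite exprn_ge0// ltW.
rewrite mulr_sumr big_seq [leRHS]big_seq; apply: ler_sum => i.
rewrite mem_undup => /mapP[k _ ->{i}].
have [/diam[_ hr] _] := uP k.
have r0 : 0 <= r (u k) := le_trans (ltW h0) hr.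
rewrite natrX -exprMn; apply: lerXn2r; rewrite ?nnegrE ?(mulr_ge0 (ltW h0)) ?mulr_ge0//.
(* 2 m + 1 <= 2 r / h + 3 <= 5 r / h, as r >= h. *)
have rh : 1 <= r (u k) / h by rewrite ler_pdivlMr// mul1r.
have /truncn_itv/andP[tr _] : 0 <= r (u k) / h by lra.
rewrite mulrC -ler_pdivlMr//.
rewrite /m -muln2 -natr1 natrM -natr1 -mulrA; lra.
Qed.

(** * Covers by grids of cubes *)

Definition box {R : realType} {d : nat} (a : 'rV[R]_d) (h : R) : set 'rV[R]_d :=
  [set x | forall j, a 0 j <= x 0 j <= a 0 j + h].

Lemma ediam_box {R : realType} {d : nat} (a : 'rV[R]_d) h : 0 <= h ->
  ediam (box a h) = (Num.sqrt d%:R * h)%:E.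
Proof.
move=> h0; have sumd : \sum_(j < d) h ^+ 2 = d%:R * h ^+ 2.
  by rewrite sumr_const card_ord mulr_natl.
have sqrtE : Num.sqrt d%:R * h = Num.sqrt (\sum_(j < d) h ^+ 2).
  by rewrite sumd sqrtrM// sqrtr_sqr ger0_norm.
apply/eqP; rewrite sqrtE eq_le; apply/andP; split.
  apply: ge_ereal_sup => _ [x ax [y ay <-]]; rewrite lee_fin.
  rewrite ler_sqrt ?sumr_ge0// => [|j _]; last exact: sqr_ge0.
  apply: ler_sum => j _; rewrite !mxE -[leLHS]real_normK ?num_real//.
  rewrite ler_sqr ?nnegrE// ler_norml.
  have /andP[? ?] := ax j; have /andP[? ?] := ay j; lra.
apply: ereal_sup_ubound; exists (a + const_mx h).
  by move=> j; rewrite !mxE; lra.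
exists a; first by move=> j; lra.
rewrite /enorm; congr (Num.sqrt _)%:E; apply: eq_bigr => j _.
by rewrite !mxE addrAC subrr add0r.
Qed.

(** The diameters equal [delta] because for [theta = 1] the definition of the
    intermediate dimensions leaves no other choice. *)
Lemma grid_cover {R : realType} {d : nat} (delta : R) : (0 < d)%N ->
    0 < delta <= 1 ->
  exists n : nat, exists Q : {ffun 'I_d -> 'I_n} -> set 'rV[R]_d,
    [/\ cube 0 2 `<=` \bigcup_k Q k, forall k, ediam (Q k) = delta%:E &
        n%:R <= 3 * d%:R / delta].
Proof.
move=> d0 /andP[delta0 delta1]; set q : R := Num.sqrt d%:R.
have dR : 1 <= d%:R :> R by rewrite ler1n.
have q0 : 0 < q by rewrite sqrtr_gt0 ltr0n.
have qd : q <= d%:R.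
  rewrite -(@ler_pXn2r _ 2) ?nnegrE ?(ltW q0)// /q sqr_sqrtr// expr2.
  by rewrite -[leLHS]mul1r ler_wpM2r.
pose h := delta / q.
have h0 : 0 < h by rewrite divr_gt0.
have /truncn_itv/andP[tr1 tr2] : 0 <= 2 / h by rewrite divr_ge0// ltW.
set n := (Num.truncn (2 / h)).+1 in tr2.
exists n, (fun k : {ffun 'I_d -> 'I_n} => box (\row_j (h * (k j)%:R)) h); split.
- move=> x x02.
  have /choice[k kP] : forall j, exists i : 'I_n,
      h * i%:R <= x 0 j <= h * i%:R + h.
    move=> j; have /andP[x0 x2] := x02 j.
    have xh0 : 0 <= x 0 j / h by rewrite divr_ge0// ltW.
    have /andP[y1 y2] := truncn_itv xh0.
    have y3 : (Num.truncn (x 0%R j / h)%R < n)%N.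
      rewrite truncn_lt_nat//.
      apply: (@le_lt_trans _ _ (2 / h)); last exact: tr2.
      by rewrite ler_pM2r ?invr_gt0.
    exists (Ordinal y3) => /=.
    rewrite ler_pdivlMr// in y1; rewrite ltr_pdivrMr// -natr1 in y2.
    by rewrite mulrC; apply/andP; split; lra.
  by exists [ffun j => k j] => // j; rewrite mxE ffunE.
- by move=> k; rewrite ediam_box ?(ltW h0)// /h mulrC divfK// gt_eqF.
- apply: (@le_trans _ _ (2 / h + 1)); first by rewrite /n -natr1 lerD.
  rewrite ler_pdivlMr// mulrDl mul1r.
  have -> : 2 / h * delta = 2 * q by rewrite /h; field; rewrite !gt_eqF.
  lra.
Qed.

(** * Intermediate dimensions *)

Lemma esum_range_const {R : realType} (I : finType) (T : choiceType)
    (Q : I -> T) (f : T -> \bar R) c :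
  0 <= c -> (forall i, f (Q i) = c%:E) ->
  (\esum_(U in range Q) f U <= (#|I|%:R * c)%:E)%E.
Proof.
move=> c0 fQ; have rangeE : range Q = [set` undup [seq Q i | i : I]].
  apply/seteqP; split=> [_ [i _ <-]|U]; rewrite /= mem_undup.
    by apply/mapP; exists i; rewrite // mem_enum.
  by move=> /mapP[i _ ->]; exists i.
rewrite rangeE esum_fset => [||U]; last 2 first.
- exact: finite_seq.
- by rewrite -rangeE inE => -[i _ <-]; rewrite fQ lee_fin.
rewrite -fsbig_seq ?undup_uniq// big_seq (eq_bigr (fun=> c%:E)) => [|U]; last first.
  by rewrite mem_undup => /mapP[i _ ->].
rewrite -big_seq sumEFin lee_fin big_const_seq count_predT iter_addr_0.
rewrite -[leLHS]mulr_natl ler_wpM2r// ler_nat (leq_trans (size_undup _))//.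
by rewrite size_map -cardE.
Qed.

Lemma scaled_cover_grid {R : realType} {d : nat} (E : set 'rV[R]_d)
    (theta s eps delta : R) :
    (0 < d)%N -> E `<=` cube 0 2 -> 0 < theta <= 1 -> 0 < delta <= 1 ->
    (3 * d%:R) ^+ d * delta `^ (s - d%:R) <= eps ->
  scaled_cover theta s eps delta E.
Proof.
move=> d0 E02 /andP[theta0 theta1] delta01 epsP; have /andP[delta0 delta1] := delta01.
have [n [Q [cov diam nle]]] := grid_cover d0 delta01.
exists (range Q); split.
- exact/finite_set_countable/finite_image.
- by move=> x /E02/cov[k _ Qx]; exists (Q k) => //; exists k.
- move=> _ [k _ <-]; rewrite diam !lee_fin lexx andbT.
  by rewrite ge1r_powR// invf_ge1.
apply: (le_trans (@esum_range_const R _ _ Q _ (delta `^ s) _ _)).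
- exact: powR_ge0.
- by move=> k; rewrite diam poweR_EFin.
rewrite lee_fin card_ffun !card_ord; apply: le_trans epsP.
have -> : delta `^ s = delta ^+ d * delta `^ (s - d%:R).
  rewrite -powR_mulrn ?(ltW delta0)// -powRD ?(addrC d%:R) ?subrK//.
  by rewrite (gt_eqF delta0) implybT.
rewrite mulrA.
rewrite ler_wpM2r ?powR_ge0// natrX -exprMn lerXn2r ?nnegrE ?mulr_ge0 ?(ltW delta0)//.
by rewrite -ler_pdivlMr.
Qed.

Lemma upper_intermediate_dim_le {R : realType} {d : nat} (E : set 'rV[R]_d)
    (theta : R) :
  (0 < d)%N -> E `<=` cube 0 2 -> 0 < theta <= 1 ->
  (upper_intermediate_dim theta E <= d%:R%:E)%E.
Proof.
move=> d0 E02 th; apply/lee_addgt0Pr => e e0.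
apply: ereal_inf_lbound; exists (d%:R + e) => //; split.
  by rewrite addr_ge0// ltW.
move=> eps eps0; set K := (3 * d%:R) ^+ d : R.
have K0 : 0 < K by rewrite exprn_gt0// mulr_gt0 ?ltr0n.
have g0 : 0 < (eps / K) `^ e^-1 by apply: powR_gt0; rewrite divr_gt0.
exists (Num.min 1 ((eps / K) `^ e^-1)) => [|delta].
  by rewrite lt_min ltr01 g0 ge_min lexx.
rewrite lt_min => /and3P[delta0 delta1 deltag]; apply: scaled_cover_grid => //.
  by rewrite delta0 ltW.
rewrite addrAC subrr add0r mulrC -ler_pdivlMr//.
have gK : ((eps / K) `^ e^-1) `^ e = eps / K.
  by rewrite -powRrM mulVf ?gt_eqF// powRr1// divr_ge0 ?(ltW eps0) ?(ltW K0).
rewrite -gK.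
by apply: (ge0_ler_powR (ltW e0)); rewrite ?nnegrE ltW.
Qed.

Lemma lower_le_upper_intermediate_dim {R : realType} {d : nat}
    (E : set 'rV[R]_d) (theta : R) :
  (lower_intermediate_dim theta E <= upper_intermediate_dim theta E)%E.
Proof.
apply: ereal_inf_le_tmp => _ [s [s0 sE] <-]; exists s => //; split=> //.
move=> eps delta0 eps0 /andP[d0 d1]; have [delta1 /andP[e0 e1] cov] := sE _ eps0.
exists (Num.min delta0 delta1 / 2).
  by case: (leP delta0 delta1) => ?; lra.
by apply: cov; case: (leP delta0 delta1) => ?; lra.
Qed.

(** All diameters lie between [g = delta ^ (1 / theta)] and 1: the lower bound
    makes the counting argument available, with a mesh below [g], and the upper
    bound gives [r ^ d <= r ^ s] whenever [s < d]. *)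
Lemma le_lower_intermediate_dim {R : realType} {d : nat} (E : set 'rV[R]_d)
    x e (theta : R) :
  0 < e -> ball x e `<=` closure E -> 0 < theta ->
  (d%:R%:E <= lower_intermediate_dim theta E)%E.
Proof.
move=> e0 xE th0; apply/ereal_infP => _ [s [s0 sE] <-].
rewrite lee_fin leNgt; apply/negP => sd.
(* Every cover has mass at least c, so a sum of at most c / 2 is absurd. *)
pose c : R := (2 * e / 5) ^+ d; have c0 : 0 < c by rewrite exprn_gt0 ?divr_gt0 ?mulr_gt0.
have [||delta /andP[delta0 delta1] [C [_ cov diam sumC]]] := sE (c / 2) 1.
- by rewrite divr_gt0.
- by rewrite ltr01 lexx.
pose g := delta `^ theta^-1; have g0 : 0 < g by rewrite powR_gt0.
pose M := (Num.truncn (2 * e / g)).+1.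
have Mg : 2 * e / M%:R <= g.
  have /truncn_itv/andP[_ /ltW] : 0 <= 2 * e / g.
    by rewrite divr_ge0 ?mulr_ge0 ?(ltW e0) ?(ltW g0).
  by rewrite -/M ler_pdivrMr// [X in _ <= X]mulrC -ler_pdivrMr ?ltr0n.
have fineC U : C U -> ediam U = (fine (ediam U))%:E /\ g <= fine (ediam U) <= delta.
  move=> /diam; rewrite -/g; case: (ediam U) => [r|/andP[]//|/andP[]//].
  by rewrite !lee_fin.
have [||r [runiq rC rsum]] := @cover_mass R d E x e M _ C id
    (fun U => fine (ediam U)) e0 _ xE cov.
- by [].
- move=> U /fineC[eU /andP[gU _]]; split; first by rewrite -eU.
  exact: le_trans gU.
have : (c%:E <= \esum_(U in C) (ediam U `^ s))%E.
  apply: esum_ge; exists [set` r]; first by split=> // U /rC.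
  rewrite -fsbig_seq// big_seq.
  have powE U : U \in r -> (ediam U `^ s)%E = (fine (ediam U) `^ s)%:E.
    by move=> /rC/fineC[eU _]; rewrite {1}eU poweR_EFin.
  rewrite (eq_bigr _ powE).
  rewrite -big_seq sumEFin lee_fin /c expr_div_n ler_pdivrMr ?exprn_gt0//.
  apply: le_trans rsum _; rewrite mulr_suml !big_seq.
  apply: ler_sum => U /rC/fineC[_ /andP[gU Ud]].
  have U0 : 0 < fine (ediam U) by exact: lt_le_trans gU.
  rewrite exprMn mulrC ler_wpM2r ?exprn_ge0// -powR_mulrn ?(ltW U0)//.
  by apply: ger_powR; [rewrite U0 (le_trans Ud) ?ltW | exact: ltW].
move=> /le_trans/(_ sumC); rewrite lee_fin; lra.
Qed.

Lemma has_intermediate_dim_full {R : realType} {d : nat} (E : set 'rV[R]_d)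
    x e (theta : R) :
  (0 < d)%N -> E `<=` cube 0 2 -> 0 < e -> ball x e `<=` closure E ->
  0 < theta <= 1 -> has_intermediate_dim theta E d%:R%:E.
Proof.
move=> d0 E02 e0 xE th; have /andP[th0 _] := th.
have up := upper_intermediate_dim_le d0 E02 th.
have lo := le_lower_intermediate_dim e0 xE th0.
have lu := lower_le_upper_intermediate_dim E theta.
split; apply/eqP; rewrite eq_le; apply/andP; split=> //.
- exact: le_trans up.
- exact: le_trans lu.
Qed.

(** * Box dimension *)

Lemma limf_sandwich {R : realType} {T : choiceType} {X : filteredType T}
    (F : set_system X) {FF : ProperFilter F} (f : X -> \bar R) (l : R) :
  (forall eps, 0 < eps ->
     \forall x \near F, ((l - eps)%:E <= f x <= (l + eps)%:E)%E) ->
  limf_einf f F = l%:E /\ limf_esup f F = l%:E.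
Proof.
have esup (g : X -> \bar R) (m : R) : (forall eps, 0 < eps ->
      \forall x \near F, ((m - eps)%:E <= g x <= (m + eps)%:E)%E) ->
    limf_esup g F = m%:E.
  move=> gm; rewrite limf_esupE; apply/eqP; rewrite eq_le; apply/andP; split.
    apply/lee_addgt0Pr => e e0; rewrite -EFinD.
    apply: le_trans (ereal_inf_lbound _) _; first by eexists; [exact: gm e0|].
    by apply: ge_ereal_sup => _ [x /andP[_ ?] <-].
  apply/ereal_infP => _ [V FV <-]; apply/lee_addgt0Pr => e e0.
  have [x [Vx /andP[gx _]]] := filter_ex (@filterI _ F _ _ _ FV (gm _ e0)).
  rewrite -leeBlDr// -EFinB; apply: le_trans gx _.
  by apply: ereal_sup_ubound; exists x.
move=> fl; split; last exact: esup.
apply: oppe_inj; rewrite -limf_esupN; apply: esup => e e0.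
near=> x; have /andP[lo hi] : ((l - e)%:E <= f x <= (l + e)%:E)%E.
  by near: x; exact: fl.
rewrite leeNr leeNl -!EFinN; apply/andP; split.
  by rewrite opprB addrC opprK.
by rewrite opprD opprK.
Unshelve. all: by end_near. Qed.

(** The lower bound uses the counting argument with the finest mesh [2 * e / M]
    that is at least [delta]; the rounding of [M] costs a factor of at most 2. *)
Lemma covering_number_bounds {R : realType} {d : nat} (E : set 'rV[R]_d)
    x e delta :
  (0 < d)%N -> E `<=` cube 0 2 -> 0 < e -> ball x e `<=` closure E ->
  0 < delta < 2 * e -> delta <= 1 ->
  (e / 5 / delta) ^+ d <= covering_number E delta <= (3 * d%:R / delta) ^+ d.
Proof.
move=> d0 E02 e0 xE /andP[delta0 deltae] delta1; rewrite /covering_number.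
set N := (X in inf X).
have [|n [Q [cov diam nle]]] := @grid_cover R d delta d0; first by rewrite delta0.
have NQ : N (n ^ d)%N%:R.
  exists (n ^ d)%N => //; have cardE : (n ^ d)%N = #|{ffun 'I_d -> 'I_n}|.
    by rewrite card_ffun !card_ord.
  exists (fun i => Q (enum_val (cast_ord cardE i))); split=> [y|i].
    move=> /E02/cov[k _ Qy]; exists (cast_ord (esym cardE) (enum_rank k)) => //.
    by rewrite cast_ordKV enum_rankK.
  by rewrite diam.
apply/andP; split; last first.
  apply: (@le_trans _ _ (n ^ d)%N%:R).
    by apply: ge_inf => //; exists 0 => _ [m _ <-].
  by rewrite natrX lerXn2r ?nnegrE ?divr_ge0 ?mulr_ge0 ?(ltW delta0).
apply: lb_le_inf; first by exists (n ^ d)%N%:R.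
move=> _ [m [U [covU diamU]] <-].
pose M := Num.truncn (2 * e / delta).
have q0 : 0 <= 2 * e / delta by rewrite divr_ge0 ?mulr_ge0 ?(ltW e0) ?(ltW delta0).
have /andP[Mle Mgt] := truncn_itv q0; rewrite -/M in Mle Mgt.
have M0 : (0 < M)%N by rewrite truncn_gt0 ler_pdivlMr// mul1r ltW.
have M0' : 0 < M%:R :> R by rewrite ltr0n.
have deltaM : delta <= 2 * e / M%:R.
  by rewrite ler_pdivlMr// mulrC -ler_pdivlMr.
have [||r [runiq _ rsum]] := @cover_mass R d E x e M _ setT U
    (fun=> 2 * e / M%:R) e0 M0 xE.
- by move=> y /covU[i _ Ui]; exists i.
- by move=> i _; split=> //; apply: le_trans (diamU i) _; rewrite lee_fin.
rewrite big_const_seq count_predT iter_addr_0 -[leRHS]mulr_natl in rsum.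
have rm : (size r <= m)%N 
  by rewrite -(card_uniqP runiq) (leq_trans (max_card _))// card_ord.
have : (2 * e) ^+ d <= m%:R * (5 * (2 * e / M%:R)) ^+ d.
  apply: le_trans rsum _; rewrite ler_wpM2r ?ler_nat// exprn_ge0//.
  by rewrite mulr_ge0 ?divr_ge0 ?mulr_ge0 ?(ltW e0).
have -> : 5 * (2 * e / M%:R) = 2 * e * (5 / M%:R).
  by field; rewrite gt_eqF.
rewrite [(2 * e * _) ^+ d]exprMn mulrCA -[leLHS]mulr1 ler_pM2l ?exprn_gt0 ?mulr_gt0//.
have M5 : 0 < 5 / M%:R :> R by rewrite divr_gt0.
rewrite -ler_pdivrMr ?exprn_gt0// mul1r -exprVn invf_div.
apply: le_trans; rewrite lerXn2r ?nnegrE ?divr_ge0 ?(ltW e0) ?(ltW delta0)//.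
rewrite ler_pdivlMr// mulrAC divfK ?pnatr_eq0//.
have M1 : 1 <= M%:R :> R by rewrite ler1n.
by move: Mgt; rewrite -(natr1 M) -mulrA => Mgt; lra.
Qed.

(** Both bounds of the covering number have logarithm
    [d * (a - ln delta)] with [a] independent of [delta], so the box ratio differs
    from [d] by at most [d * K / - ln delta] for a constant [K]. *)
Lemma has_box_dim_full {R : realType} {d : nat} (E : set 'rV[R]_d) x e :
  (0 < d)%N -> E `<=` cube 0 2 -> 0 < e -> ball x e `<=` closure E ->
  has_box_dim E d%:R%:E.
Proof.
move=> d0 E02 e0 xE; apply: limf_sandwich => eps eps0.
have e5 : 0 < e / 5 by rewrite divr_gt0.
have d3 : 0 < 3 * d%:R :> R by rewrite mulr_gt0 ?ltr0n.
pose K := `|ln (e / 5)| + `|ln (3 * d%:R : R)| + 1.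
have K0 : 0 < K by rewrite ltr_wpDl// addr_ge0.
have Keps : 0 < d%:R * K / eps by rewrite divr_gt0 ?mulr_gt0 ?ltr0n.
pose delta0 : R := Num.min (2 * e) (expR (- (d%:R * K / eps))).
have delta00 : 0 < delta0 by rewrite lt_min mulr_gt0// expR_gt0.
near=> delta.
have delta_gt0 : 0 < delta by near: delta; exact: nbhs_right_gt.
have : delta < delta0 by near: delta; exact: nbhs_right_lt.
rewrite lt_min => /andP[deltae]; rewrite -[X in _ < expR X]opprK => deltaK.
have lndelta : d%:R * K / eps < - ln delta.
  by rewrite ltrNr -ltr_expR lnK ?posrE// -[X in expR X]opprK.
have L0 : 0 < - ln delta by exact: lt_trans lndelta.
have delta1 : delta <= 1.
  by rewrite -(lnK delta_gt0) -expR0 ler_expR -oppr_ge0 ltW.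
have /andP[lo hi] := covering_number_bounds d0 E02 e0 xE
  (introT andP (conj delta_gt0 deltae)) delta1.
have p5 : 0 < (e / 5 / delta) ^+ d by rewrite exprn_gt0 ?divr_gt0.
have p3 : 0 < (3 * d%:R / delta) ^+ d by rewrite exprn_gt0 ?divr_gt0.
have N0 : 0 < covering_number E delta by exact: lt_le_trans lo.
rewrite -ler_ln ?posrE// lnXn ?divr_gt0// ln_div ?posrE// -[leLHS]mulr_natl in lo.
rewrite -ler_ln ?posrE// lnXn ?divr_gt0// ln_div ?posrE// -[leRHS]mulr_natl in hi.
rewrite !lee_fin ler_pdivlMr// ler_pdivrMr//.
have dKL : d%:R * K <= eps * - ln delta by rewrite [leRHS]mulrC -ler_pdivrMr// ltW.
have dK a : `|a| <= K -> `|d%:R * a| <= eps * - ln delta.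
  move=> aK; apply: le_trans dKL; rewrite normrM normr_nat ler_wpM2l//.
have /dK : `|ln (e / 5)| <= K by rewrite /K -addrA lerDl addr_ge0.
have /dK : `|ln (3 * d%:R : R)| <= K.
  by rewrite /K addrAC lerDr addr_ge0.
rewrite !ler_norml => /andP[_ h1] /andP[h2 _].
apply/andP; split.
  apply: le_trans lo; lra.
apply: (le_trans hi); lra.
Unshelve. all: by end_near. Qed.

(** * Fixed points and the limit set *)

Lemma enorm_le_coord {R : realType} {d : nat} (x : 'rV[R]_d) c : 0 <= c ->
  (forall j, `|x 0 j| <= c) -> enorm x <= d%:R * c.
Proof.
move=> c0 xc; rewrite -(@ler_pXn2r _ 2) ?nnegrE ?mulr_ge0 ?enorm_ge0//.
rewrite sqr_enorm (@le_trans _ _ (d%:R * c ^+ 2))//.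
  rewrite -[d in leRHS]card_ord mulr_natl -sumr_const; apply: ler_sum => j _.
  by rewrite -real_normK ?num_real// ler_sqr ?nnegrE.
rewrite exprMn ler_wpM2r ?sqr_ge0// -natrX ler_nat.
by case: d {x xc} => // n; rewrite expnS expn1 leq_pmull.
Qed.

Lemma enorm_dist_triangle {R : realType} {d : nat} (x y z : 'rV[R]_d) :
  enorm (x - z) <= enorm (x - y) + enorm (y - z).
Proof. by rewrite -[x - z](subrKA y) enorm_triangle. Qed.

(** Minimizing the displacement [enorm (f x - x)] over the compact set gives the
    fixed point: applying [f] multiplies the displacement by at most [rho < 1].
    The contraction is with respect to the Euclidean norm and need not be one for
    the sup norm that carries the topology. *)
Lemma contraction_fixed_point {R : realType} {d : nat} (X : set 'rV[R]_d)
    (f : 'rV[R]_d -> 'rV[R]_d) rho :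
  compact X -> X !=set0 -> f @` X `<=` X -> 0 <= rho < 1 ->
  is_lipschitz_on X rho f -> exists2 x, X x & f x = x.
Proof.
move=> cX X0 fX /andP[rho0 rho1] lip; pose g x := enorm (f x - x).
have gcont : {within X, continuous g}.
  apply/subspace_continuousP => x Xx; apply/cvgrPdist_le => e e0.
  pose b := e / (2 * d.+1%:R); have b0 : 0 < b by rewrite divr_gt0 ?mulr_gt0.
  rewrite near_withinE; near=> y => Xy.
  have xy : enorm (x - y) <= e / 2.
    apply: (@le_trans _ _ (d%:R * b)).
      apply: enorm_le_coord (ltW b0) _ => j; rewrite !mxE; apply/ltW; move: j.
      by apply/rV_ballP => //; near: y; exact: nbhsx_ballx.
    have -> : e / 2 = d.+1%:R * b.
      have : d.+1%:R != 0 :> R by rewrite pnatr_eq0.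
      by rewrite /b; move: (d.+1%:R) => q q0; field.
    by rewrite ler_wpM2r ?(ltW b0)// ler_nat.
  have fxy : enorm (f x - f y) <= e / 2.
    apply: le_trans (lip _ _ Xx Xy) _; apply: le_trans xy.
    by rewrite -[leRHS]mul1r ler_wpM2r ?enorm_ge0// ltW.
  have xy' : enorm (y - x) <= e / 2 by rewrite -opprB enormN.
  have fxy' : enorm (f y - f x) <= e / 2 by rewrite -opprB enormN.
  have h1 := enorm_dist_triangle (f x) (f y) x; have h2 := enorm_dist_triangle (f y) y x.
  have h3 := enorm_dist_triangle (f y) (f x) y; have h4 := enorm_dist_triangle (f x) x y.
  suff : `|g x - g y| <= e by [].
  by rewrite ler_norml /g; apply/andP; split; lra.
have [x /set_mem Xx gmin] := compact_EVT_min X0 cX gcont.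
exists x => //; have Xfx : X (f x) by apply: fX; exists x.
have := gmin _ (mem_set Xfx); have := lip _ _ Xfx Xx; rewrite -/(g x) -/(g (f x)).
have := enorm_ge0 (f x - x); rewrite -/(g x) => g0 h1 h2.
have gx : g x = 0 by apply/eqP; rewrite eq_le g0 andbT; nra.
by apply/eqP; rewrite -subr_eq0; apply/eqP/enorm_eq0.
Unshelve. all: by end_near. Qed.

Lemma fixed_point_limit_set {R : realType} {d : nat} (X : set 'rV[R]_d)
    (S : nat -> 'rV[R]_d -> 'rV[R]_d) i x :
  X x -> S i x = x -> limit_set X S x.
Proof.
move=> Xx Six; exists (fun=> i) => // n _; exists x => //.
have fix_foldr (w : seq nat) : foldr S x [seq i | _ <- w] = x.
  by elim: w => //= _ w ->.
exact: fix_foldr.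
Qed.

Lemma limit_set_sub {R : realType} {d : nat} (X : set 'rV[R]_d)
    (S : nat -> 'rV[R]_d -> 'rV[R]_d) :
  (forall i, S i @` X `<=` X) -> limit_set X S `<=` X.
Proof.
move=> SX x [w _ /(_ 1%N)]/= /(_ isT)[y Xy <-].
by apply: (SX (w 0%N)); exists y.
Qed.

(** * Residual sets of translations *)

Lemma residual_countable_bigcap {T : topologicalType} {J : countType}
    (G : J -> set T) :
  (forall i, open (G i) /\ dense (G i)) -> residual (\bigcap_i G i).
Proof.
move=> oG; exists (fun n => if unpickle n is Some i then G i else setT).
split=> [n|t Gt i _]; last by have := Gt (pickle i) I; rewrite pickleK.
case: unpickle => //; split; first exact: openT.
by move=> O [x Ox] _; exists x.
Qed.

Lemma enorm_coord_le_tdist {R : realType} {d : nat} (t s : translations R d) i :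
  enorm (val (t i) - val (s i)) <= i.+1%:R * tdist t s.
Proof.
have i0 : 0 < i.+1%:R :> R by rewrite ltr0n.
rewrite mulrC -ler_pdivrMr//.
rewrite -(@ler_pXn2r _ 2) ?nnegrE ?divr_ge0 ?enorm_ge0 ?sqrtr_ge0//.
rewrite expr_div_n [leRHS](sqr_sqrtr (tdist_lim_ge0 t s)).
apply: le_trans _ (tdist_partial_le t s i.+1); rewrite seriesEnat/=.
rewrite big_nat_recr//= lerDr sumr_ge0// => k _; exact: tdist_term_ge0.
Qed.

Lemma tdist_one_coord {R : realType} {d : nat} (t s : translations R d) i :
  (forall k, k != i -> t k = s k) -> tdist t s <= d%:R / i.+1%:R.
Proof.
move=> ts; have i0 : 0 < i.+1%:R :> R by rewrite ltr0n.
have di : 0 <= d%:R / i.+1%:R :> R by rewrite divr_ge0.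
rewrite -[leRHS]ger0_norm// -sqrtr_sqr ler_sqrt ?sqr_ge0//.
apply: limr_le; first exact: is_cvg_tdist.
near=> n; apply: (@le_trans _ _ (tdist_term t s i)).
  rewrite seriesEnat/= (eq_bigr (fun k => if k == i then tdist_term t s k else 0)).
    by rewrite -big_mkcond big_nat1_eq; case: ifP => // _; exact: tdist_term_ge0.
  move=> k _; case: ifPn => // /ts tsk.
  by rewrite /tdist_term tsk subrr enorm0 expr0n mul0r.
apply: le_trans (tdist_term_le _ _ _) _.
rewrite expr_div_n ler_wpM2r ?invr_ge0 ?sqr_ge0// -natrX ler_nat.
by case: d {t s ts di} => // m; rewrite expnS expn1 leq_pmull.
Unshelve. all: by end_near. Qed.

Definition visits {R : realType} {d : nat} (P : nat -> Prop) (g : 'rV[R]_d)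
    (e : R) : set (translations R d) :=
  [set t : translations R d |
     exists2 i, P i & forall j, `|val (t i) 0 j - g 0 j| < e].

Lemma open_visits {R : realType} {d : nat} (P : nat -> Prop) (g : 'rV[R]_d) e :
  open (visits P g e).
Proof.
rewrite openE => t [i Pi tg]; apply/nbhs_ballP.
pose b := \big[Order.min/(1 : R)]_(j < d) (e - `|val (t i) 0 j - g 0 j|).
have b0 : 0 < b by apply: lt_bigmin => // j _; rewrite subr_gt0.
exists (b / i.+1%:R) => /=; first by rewrite divr_gt0.
move=> s ts; exists i => // j.
have h1 : tdist t s * i.+1%:R < b by rewrite -ltr_pdivlMr.
have h2 := le_trans (coord_le_enorm _ j) (enorm_coord_le_tdist t s i).
have h3 : b <= e - `|val (t i) 0 j - g 0 j| by exact: bigmin_le_cond.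
have h4 := ler_distD (val (t i) 0 j) (val (s i) 0 j) (g 0 j).
rewrite !mxE in h2; rewrite distrC in h2.
lra.
Qed.

(** Replacing [t i] by [g] moves [t] by at most [d / (i + 1)], and [P] holds at
    arbitrarily large times [i]. *)
Lemma dense_visits {R : realType} {d : nat} (P : nat -> Prop) (g : 'rV[R]_d) e :
  0 < e -> unit_box R d g -> (forall N, exists2 i, P i & (N <= i)%N) ->
  dense (visits P g e).
Proof.
move=> e0 g01 freq O [t Ot] oO.
have /nbhs_ballP[b /= b0 tO] : nbhs t O by exact: open_nbhs_nbhs.
have [i Pi Ni] := freq (Num.truncn (d%:R / b)).
pose s : translations R d := fun k =>
  if k == i then exist _ g (mem_set g01) else t k.
exists s; split.
  apply: tO; apply: (@le_lt_trans _ _ (d%:R / i.+1%:R)).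
    by apply: tdist_one_coord => k ki; rewrite /s (negPf ki).
  rewrite ltr_pdivrMr ?ltr0n// mulrC -ltr_pdivrMr//.
  have /truncn_itv/andP[_ /lt_le_trans] : 0 <= d%:R / b by rewrite divr_ge0// ltW.
  by apply; rewrite ler_nat ltnS.
by exists i => // j; rewrite /s eqxx /= subrr normr0.
Qed.

(** * Density of the attractor *)

Lemma lipschitz_lt_contraction_ratio {R : realType} {d : nat}
    (X : set 'rV[R]_d) f rho c :
  0 <= rho -> is_lipschitz_on X rho f -> contraction_ratio X f < c ->
  exists2 c', 0 <= c' < c & is_lipschitz_on X c' f.
Proof.
move=> rho0 lip lt_c; set L := [set c | 0 <= c /\ is_lipschitz_on X c f].
have infL : has_inf L.
  by split; [exists rho | exists 0 => r []].
have : 0 < c - contraction_ratio X f by rewrite subr_gt0.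
move=> /inf_adherent/(_ infL)[c' [c'0 c'lip]].
by rewrite [_ + _]addrC subrK => c'c; exists c' => //; rewrite c'0.
Qed.

Lemma cluster_point_seq {R : realType} {d : nat} (X : set 'rV[R]_d)
    (a : nat -> 'rV[R]_d) :
  compact X -> (forall i, X (a i)) -> exists c : 'rV[R]_d, forall e N, 0 < e ->
    exists2 i, (N <= i)%N & forall j, `|a i 0 j - c 0 j| < e.
Proof.
move=> cX Xa; have aX : (a @ \oo) X by exists 0%N => // i _; exact: Xa.
have [c [_ cc]] := cX (a @ \oo) _ aX.
exists c => e N e0.
have aN : (a @ \oo) [set a i | i in [set i | (N <= i)%N]].
  by exists N => // i Ni; exists i.
have [y [[i Ni <-] /rV_ballP ci]] := cc _ _ aN (nbhsx_ballx c e e0).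
by exists i => // j; rewrite distrC; exact: ci.
Qed.

(** Truncating the numerators at [n] keeps the points in the half-open unit box
    for every [k], so that pairs [(n, k)] form a countable index type with no side
    condition. *)
Definition grid_point {R : realType} {d : nat} n (k : {ffun 'I_d -> nat}) :
    'rV[R]_d := \row_j ((minn (k j) n)%:R / n.+1%:R).

Lemma unit_box_grid_point {R : realType} {d : nat} n (k : {ffun 'I_d -> nat}) :
  unit_box R d (grid_point n k).
Proof.
move=> j; rewrite mxE divr_ge0//= ltr_pdivrMr ?ltr0n// mul1r ltr_nat.
by rewrite ltnS geq_minr.
Qed.

Lemma grid_point_near {R : realType} {d : nat} n (y : 'rV[R]_d) :
  unit_box R d y ->
  exists k, forall j, `|grid_point n k 0 j - y 0 j| <= n.+1%:R^-1.
Proof.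
move=> y01; exists [ffun j => Num.truncn (y 0 j * n.+1%:R)] => j.
have /andP[y0 y1] := y01 j; have n0 : 0 < n.+1%:R :> R by rewrite ltr0n.
have yn : 0 <= y 0 j * n.+1%:R by rewrite mulr_ge0.
have /andP[t1 t2] := truncn_itv yn.
have tn : (Num.truncn (y 0%R j * n.+1%:R) <= n)%N.
  by rewrite -ltnS truncn_lt_nat// -[ltRHS]mul1r ltr_pM2r.
rewrite mxE ffunE (minn_idPl tn).
move: (Num.truncn _) t1 t2 {tn} => m t1; rewrite -(natr1 m) => t2.
have -> : m%:R / n.+1%:R - y 0 j = (m%:R - y 0 j * n.+1%:R) / n.+1%:R.
  by rewrite mulrBl mulfK ?gt_eqF.
rewrite normrM [X in _ * X]gtr0_norm ?invr_gt0//.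
rewrite -[leRHS]mul1r ler_pM2r ?invr_gt0// ler_norml.
by apply/andP; split; lra.
Qed.

Lemma translate_cube {R : realType} {d : nat} (S : nat -> 'rV[R]_d -> 'rV[R]_d)
    (t : translations R d) i :
  (forall i, S i @` cube 0 2 `<=` cube 0 1) ->
  translate S t i @` cube 0 2 `<=` cube 0 2.
Proof.
move=> hS01 _ [x x02 <-] j; rewrite /translate mxE.
have /(_ j)/andP[Sx0 Sx1] : cube 0 1 (S i x) by apply: hS01; exists x.
have /(_ j)/andP[t0 t1] := set_valP (t i).
by rewrite /set_val/= in t0 t1; apply/andP; split; lra.
Qed.

(** A fixed point [x] of [S i + t i] satisfies [x - (S i 0 + t i) = S i x - S i 0],
    and points of the cube have Euclidean norm at most [2 * d]. *)
Lemma attractor_near {R : realType} {d : nat} (S : nat -> 'rV[R]_d -> 'rV[R]_d)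
    (t : translations R d) i c :
  is_IIFS (cube 0 2) S -> (forall i, S i @` cube 0 2 `<=` cube 0 1) ->
  0 <= c -> is_lipschitz_on (cube 0 2) c (S i) ->
  exists2 x, limit_set (cube 0 2) (translate S t) x &
    forall j, `|x 0 j - (S i 0 0 j + val (t i) 0 j)| <= c * (d%:R * 2).
Proof.
move=> [cX _ _ _ [rho rho01 Slip]] hS01 c0 lip.
have X0 : cube 0 2 (0 : 'rV[R]_d) by move=> j; rewrite mxE lexx /=.
have Tlip : is_lipschitz_on (cube 0 2) rho (translate S t i).
  by move=> x y Xx Xy; rewrite /translate opprD addrACA subrr addr0; exact: Slip.
have [|x Xx Tx] := contraction_fixed_point cX _
  (@translate_cube _ _ S t i hS01) rho01 Tlip.
  by exists 0.
exists x; first exact: fixed_point_limit_set Tx.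
move=> j; have -> : x 0 j - (S i 0 0 j + val (t i) 0 j) = (S i x - S i 0) 0 j.
  by rewrite -{1}Tx /translate !mxE; lra.
apply: le_trans (coord_le_enorm _ j) _; apply: le_trans (lip _ _ Xx X0) _.
rewrite ler_wpM2l// subr0; apply: enorm_le_coord => // k.
by have /andP[? ?] := Xx k; rewrite ler_norml; apply/andP; split; lra.
Qed.

Lemma residual_attractor_dense {R : realType} {d : nat}
    (S : nat -> 'rV[R]_d -> 'rV[R]_d) :
  is_IIFS (cube 0 2) S -> (forall i, S i @` cube 0 2 `<=` cube 0 1) ->
  (fun i => contraction_ratio (cube 0 2) (S i)) @ \oo --> (0 : R) ->
  exists2 A : set (translations R d), residual A &
    exists x : 'rV[R]_d, forall t, A t ->
      ball x (1 / 2) `<=` closure (limit_set (cube 0 2) (translate S t)).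
Proof.
move=> hIIFS hS01 hratio; have [cX _ _ SX [rho /andP[rho0 _] Slip]] := hIIFS.
have [c cP] : exists c : 'rV[R]_d, forall e N, 0 < e ->
    exists2 i, (N <= i)%N & forall j, `|S i 0 0 j - c 0 j| < e.
  apply: cluster_point_seq cX _ => i; apply: SX; exists 0 => // j.
  by rewrite mxE lexx /=.
pose P n i := (n <= i)%N /\ forall j, `|S i 0 0 j - c 0 j| < n.+1%:R^-1.
pose G (nk : nat * {ffun 'I_d -> nat}) : set (translations R d) :=
  visits (P nk.1) (grid_point nk.1 nk.2) nk.1.+1%:R^-1.
(* For t in every G (n, k), taking n large makes the time i large, and makes
   S i 0 close to c and t i close to any given point of the unit box. *)
exists (\bigcap_nk G nk).
  apply: residual_countable_bigcap => -[n k]; split; first exact: open_visits.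
  apply: dense_visits; [by rewrite invr_gt0|exact: unit_box_grid_point|].
  move=> N; have [|i] := cP n.+1%:R^-1 (maxn n N); first by rewrite invr_gt0.
  by rewrite geq_max => /andP[ni Ni] ci; exists i.
(* c + [0,1)^d contains the open ball of radius 1/2 around its centre. *)
exists (c + const_mx (1 / 2)) => t At y /rV_ballP cy B.
(* The error is the sum of four terms: the distances of the fixed point to
   S i 0 + t i, of S i 0 to c, of t i to the grid point, and of the grid point
   to y - c. *)
move=> /nbhs_ballP[e /= e0 yB]; pose eta := e / 4.
have eta0 : 0 < eta by rewrite divr_gt0.
have D0 : 0 < d%:R * 2 + 1 :> R by rewrite ltr_wpDl.
have [N _ ratioN] : \forall i \near \oo,
    contraction_ratio (cube 0 2) (S i) < eta / (d%:R * 2 + 1).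
  by apply: cvgr_lt hratio _ _; rewrite divr_gt0.
pose n := maxn N (Num.truncn eta^-1).
have n_eta : n.+1%:R^-1 <= eta.
  rewrite -[leRHS]invrK lef_pV2 ?posrE ?invr_gt0//.
  have /truncn_itv/andP[_ /ltW/le_trans] : 0 <= eta^-1 by rewrite invr_ge0 ltW.
  by apply; rewrite ler_nat ltnS leq_maxr.
have yc01 : unit_box R d (y - c).
  move=> j; rewrite !mxE; have := cy ltac:(lra) j.
  by rewrite !mxE ltr_norml => /andP[? ?]; apply/andP; split; lra.
have [k kP] := grid_point_near n yc01.
have [i [ni Sic] tik] := At (n, k) I.
have [|c' /andP[c'0 c'eta] lip] :=
  lipschitz_lt_contraction_ratio rho0 (Slip i) (ratioN i _).
  by rewrite /= (leq_trans _ ni)// leq_maxl.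
have [x Fx xP] := attractor_near t hIIFS hS01 c'0 lip.
exists x; split=> //; apply: yB; apply/rV_ballP => // j.
have h1 := xP j; have h2 := Sic j; have h3 := tik j; have h4 := kP j.
rewrite /= [(y - c) 0 j]mxE [(- c) 0 j]mxE in h2 h3 h4.
move: (grid_point n k 0 j) h3 h4 => g h3 h4.
have h5 : c' * (d%:R * 2) <= eta.
  apply: (@le_trans _ _ (eta / (d%:R * 2 + 1) * (d%:R * 2 + 1))).
    by apply: ler_pM; rewrite ?mulr_ge0 ?lerDl ?(ltW c'eta).
  by rewrite divfK ?gt_eqF.
have {}h1 := le_trans h1 h5; have {}h2 := lt_le_trans h2 n_eta.
have {}h3 := lt_le_trans h3 n_eta; have {}h4 := le_trans h4 n_eta.
rewrite ler_norml in h1; rewrite ltr_norml in h2; rewrite ltr_norml in h3.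
rewrite ler_norml in h4; case/andP: h1 => ? ?; case/andP: h2 => ? ?.
case/andP: h3 => ? ?; case/andP: h4 => ? ?.
have e4 : e = 4 * eta by rewrite /eta; field.
rewrite ltr_norml; apply/andP; split; lra.
Qed.

Theorem theorem5p4 (R : realType) (d : nat) (hd : (0 < d)%N)
    (S : nat -> 'rV[R]_d -> 'rV[R]_d)
    (hIIFS : is_IIFS (cube 0 2) S)
    (hS01 : forall i, S i @` cube 0 2 `<=` cube 0 1)
    (hratio : (fun i => contraction_ratio (cube 0 2) (S i)) @ \oo --> (0 : R)) :
  let F (t : translations R d) : set 'rV[R]_d :=
    limit_set (cube 0 2) (translate S t) in
  exists A : set (translations R d),
    residual A /\
    forall t, A t ->
      somewhere_dense (F t) /\
      forall theta : R, 0 < theta <= 1 ->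
        has_intermediate_dim theta (F t) (d%:R)%:E /\
        has_box_dim (F t) (d%:R)%:E.
Proof.
move=> F; have [A resA [x Adense]] := residual_attractor_dense hIIFS hS01 hratio.
exists A; split=> // t /Adense xF.
have F02 : F t `<=` cube 0 2.
  by apply: limit_set_sub => i; exact: translate_cube hS01.
have half0 : 0 < 1 / 2 :> R by rewrite divr_gt0.
split; first by exists x; apply/nbhs_ballP; exists (1 / 2).
move=> theta th; split; first exact: has_intermediate_dim_full xF th.
exact: has_box_dim_full xF.
Qed.
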